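(* Let $(\mathbb{X},\|\cdot\|)$ be an infinite-dimensional real Banach space, let $\mathcal{B}=(e_n)_{n=1}^\infty$ be a normalized Schauder basis of $\mathbb{X}$, and let $\omega=\{\omega_n\}_{n=1}^\infty$ be a weight sequence with $\omega_n>0$ for all $n\in\mathbb{N}$. The following are equivalent: (i) There exists $0<s\le 1$ such that $\mathcal{B}$ has the $(s,\omega)$-PCCG property. (ii) $\mathcal{B}$ is $(t,\omega)$-greedy for all $0<t\le 1$.
   Context: Let $(e_n^* )_{n=1}^\infty$ be the biorthogonal functionals of the normalized ($\|e_n\|=1$) Schauder basis $\mathcal{B}$. For a finite set $A\subset\mathbb{N}$ write $|A|$ for its cardinality, $\omega(A)=\sum_{n\in A}\omega_n$, and $P_A(x)=\sum_{n\in A}e_n^*(x)e_n$; for signs $\eta=(\eta_n)_{n\in A}$ with $\eta_n\in\{\pm1\}$ write $1_{\eta A}=\sum_{n\in A}\eta_n e_n$. The symbol $[\,\cdot\,]$ denotes linear span and $d(x,Y)=\inf_{y\in Y}\|x-y\|$. For $0<t\le 1$, $x\in\mathbb{X}$ and $m\in\mathbb{N}$, let $\mathscr{G}(x,t,m)$ be the collection of sets $\Gamma\subset\mathbb{N}$ with $|\Gamma|=m$ and $\min_{n\in\Gamma}|e_n^*(x)|\ge t\max_{n\notin\Gamma}|e_n^*(x)|$ (the $t$-greedy sets of $x$ of order $m$). For $\delta>0$ and $x\in\mathbb{X}$ put $$\sigma_\delta^\omega(x)=\inf\{d(x,[e_n: n\in A]) : A\subset\mathbb{N}\text{ finite},\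 \omega(A)\le\delta\},$$ $$\mathcal{D}_\delta^\omega(x)=\inf\{d(x,[1_{\eta A}]) : A\subset\mathbb{N}\text{ finite},\ \eta\in\{\pm1\}^A,\ \omega(A)\le\delta\}.$$ $\mathcal{B}$ is called $(t,\omega)$-greedy if there is a constant $C(t)>0$ such that $\|x-P_\Gamma(x)\|\le C(t)\,\sigma^\omega_{\omega(\Gamma)}(x)$ for all $x\in\mathbb{X}$, all $m\in\mathbb{N}$ and all $\Gamma\in\mathscr{G}(x,t,m)$. $\mathcal{B}$ has the $(t,\omega)$-PCCG property (is $(t,\omega)$-greedy for polynomials with constant coefficients) if there is a constant $D(t)>0$ such that $\|x-P_\Gamma(x)\|\le D(t)\,\mathcal{D}^\omega_{\omega(\Gamma)}(x)$ for all $x\in\mathbb{X}$, all $m\in\mathbb{N}$ and all $\Gamma\in\mathscr{G}(x,t,m)$. *)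

(* Defs.v *)
From HB Require Import structures.
From mathcomp Require Import all_boot all_order all_algebra finmap.
From mathcomp Require Import all_classical all_reals all_analysis.

Set Implicit Arguments.
Unset Strict Implicit.
Unset Printing Implicit Defensive.

Import Order.TTheory GRing.Theory Num.Theory.
Import numFieldNormedType.Exports.

Local Open Scope classical_set_scope.
Local Open Scope ring_scope.

Section Bases.
Context {R : realType} {X : completeNormedModType R}.
Implicit Types (S Y : set X) (x : X) (e : nat -> X) (w eta : nat -> R).
Implicit Types (A G : {fset nat}).

Definition lspan S : set X :=
  [set y | exists s : seq (R * X),
     (forall p, p \in s -> S p.2) /\ y = \sum_(p <- s) p.1 *: p.2].

Definition infinite_dimensional : Prop :=
  forall s : seq X, lspan [set` s] <> setT.

Definition dist x Y : R := inf [set `|x - y| | y in Y].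

Definition expands e x (a : nat -> R) : Prop :=
  series (fun n => a n *: e n) @ \oo --> x.

Definition schauder_basis e : Prop :=
  forall x, exists! a : nat -> R, expands e x a.

(* [coef e n] is the biorthogonal functional $e_n^*$: for a Schauder basis the
   chosen sequence is the unique one expanding x; the default value is used
   only when x has no expansion. *)
Definition coef e n x : R := xget (fun=> 0) (expands e x) n.

Definition proj e A x : X := \sum_(n <- A) coef e n x *: e n.

Definition weight w A : R := \sum_(n <- A) w n.

(* Only the values of eta on A matter. *)
Definition signs A eta : Prop :=
  forall n, n \in A -> eta n = 1 \/ eta n = -1.

Definition indicator e eta A : X := \sum_(n <- A) eta n *: e n.

(* min_{n in G} |e_n^*(x)| >= t max_{k notin G} |e_k^*(x)|, with the minimum and
   the maximum unfolded. *)
Definition greedy_set e x (t : R) (m : nat) : set {fset nat} :=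
  [set G | #|` G|%fset = m /\
     forall n k, n \in G -> k \notin G ->
       t * `|coef e k x| <= `|coef e n x| ].

Definition sigma e w (delta : R) x : R :=
  inf [set dist x (lspan [set e n | n in [set` A]])
      | A in [set A | weight w A <= delta]].

Definition calD e w (delta : R) x : R :=
  inf [set dist x (lspan [set indicator e p.2 p.1])
      | p in [set p : {fset nat} * (nat -> R) |
               signs p.1 p.2 /\ weight w p.1 <= delta]].

Definition greedy_basis (t : R) w e : Prop :=
  exists C : R, 0 < C /\
    forall x (m : nat) G, (0 < m)%N -> greedy_set e x t m G ->
      `|x - proj e G x| <= C * sigma e w (weight w G) x.

Definition PCCG (t : R) w e : Prop :=
  exists D : R, 0 < D /\
    forall x (m : nat) G, (0 < m)%N -> greedy_set e x t m G ->
      `|x - proj e G x| <= D * calD e w (weight w G) x.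

End Bases.

Arguments infinite_dimensional {R} X.

(* Main.v *)
Require Import Defs.
From HB Require Import structures.
From mathcomp Require Import all_boot all_order all_algebra finmap ring lra.
From mathcomp Require Import all_classical all_reals all_analysis.
Import Order.TTheory GRing.Theory Num.Theory.
Import numFieldNormedType.Exports.
(* [all_analysis] also exports a constant named [proj]. *)
Import Defs.
Local Open Scope classical_set_scope.
Local Open Scope ring_scope.

(**
  Let $D$ be a PCCG constant.  If $\alpha$ is large, $A$ is a greedy set of
  $y = x + \alpha 1_A$; since $y - P_A y = x - P_A x$ and $y - \alpha 1_A = x$,
  the PCCG inequality says $\|x - P_A x\| \le D \|x\|$: the basis is suppression
  unconditional.  If $A$ and $B$ are disjoint, $\omega(A) \le \omega(B)$ and the
  coefficients of $b = P_B b$ on $B$ are at least $m$ in modulus, then $B$ is a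
  greedy set of $m 1_{\epsilon A} + b$, so $\|m 1_{\epsilon A}\| \le D \|b\|$.
  For a $t$-greedy set $G$ of $x$ and $y \in [e_n : n \in A]$, these two facts
  bound the two terms of
  $x - P_G x = (x - y) - P_{A \cup G}(x - y) + P_{A \setminus G} x$;
  for the second one the coefficients of $P_{A \setminus G} x$ are replaced by
  extreme ones by convexity, and the element $b = P_{G \setminus A} x
  = P_{G \setminus A}(x - y)$ is used.
*)

(** * Linear spans, distances and the two error functionals *)

Section LinearSpan.
Context {R : realType} {X : completeNormedModType R}.
Implicit Types (S P : set X) (e : nat -> X) (w eta : nat -> R) (A : {fset nat}).

(** Serves as the induction principle for spans. *)
Lemma lspan_min S P : P 0 ->
  (forall a u v, S u -> P v -> P (a *: u + v)) -> lspan S `<=` P.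
Proof.
move=> P0 PS y [s [sS ->]]; elim: s sS => [|p s IH] sS; first by rewrite big_nil.
rewrite big_cons; apply: PS; first by apply: sS; rewrite inE eqxx.
by apply: IH => q qs; apply: sS; rewrite inE qs orbT.
Qed.

Lemma lspan0 S : lspan S 0.
Proof. by exists [::]; split=> //; rewrite big_nil. Qed.

Lemma lspanZ S a u : S u -> lspan S (a *: u).
Proof.
move=> Su; exists [:: (a, u)]; rewrite big_seq1; split=> // p.
by rewrite inE => /eqP ->.
Qed.

Lemma lspan_indicator e eta A :
  lspan [set indicator e eta A] `<=` lspan [set e n | n in [set` A]].
Proof.
apply: lspan_min; first exact: lspan0.
move=> a _ v -> [s [sS ->]].
exists ([seq (a * eta n, e n) | n <- enum_fset A] ++ s); split.
  move=> p; rewrite mem_cat => /orP[/mapP[n nA ->] /=|/sS//].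
  by exists n.
rewrite big_cat big_map /=; congr (_ + _).
by rewrite /indicator scaler_sumr; apply: eq_bigr => n _; rewrite scalerA.
Qed.

Lemma dist_ge0 (x : X) S : 0 <= dist x S.
Proof.
rewrite /dist; have [->|/set0P[y Sy]] := eqVneq S set0.
  by rewrite image_set0 inf0.
apply: lb_le_inf; first by exists `|x - y|; exists y.
by move=> _ [z _ <-].
Qed.

Lemma dist_le (x y : X) S : S y -> dist x S <= `|x - y|.
Proof.
move=> Sy; apply: ge_inf; last by exists y.
by exists 0 => _ [z _ <-].
Qed.

Lemma calD_le e w d (x : X) eta A (a : R) : signs A eta -> weight w A <= d ->
  calD e w d x <= `|x - a *: indicator e eta A|.
Proof.
move=> sA wA; apply: le_trans 
  (dist_le x _ (lspan [set indicator e eta A]) (lspanZ _ a _ erefl)).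
apply: ge_inf; last by exists (A, eta).
by exists 0 => _ [p _ <-]; apply: dist_ge0.
Qed.

(** The line $[1_{\eta A}]$ lies in $[e_n : n \in A]$, so each distance in [calD] dominates one in
    [sigma]. *)
Lemma sigma_le_calD e w d (x : X) : 0 <= d -> sigma e w d x <= calD e w d x.
Proof.
(* The infimum must be over a nonempty family: the empty set has weight $0 \le d$. *)
move=> d0; apply: lb_le_inf.
  eexists; exists (fset0, fun=> 1); last by [].
  by split=> //=; rewrite /weight big_seq_fset0.
move=> _ [[A eta] [_ /= wA] <-].
apply: le_trans (_ : dist x (lspan [set e n | n in [set` A]]) <= _).
  apply: ge_inf; last by exists A.
  by exists 0 => _ [B _ <-]; apply: dist_ge0.
apply: lb_le_inf; first by exists `|x - 0|; exists 0 => //; apply: lspan0.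
by move=> _ [y /lspan_indicator yA <-]; apply: dist_le.
Qed.

Lemma le_sigma e w d (x : X) c : 0 <= d ->
  (forall A y, weight w A <= d -> lspan [set e n | n in [set` A]] y ->
     c <= `|x - y|) ->
  c <= sigma e w d x.
Proof.
move=> d0 H; apply: lb_le_inf.
  by eexists; exists fset0; last by []; rewrite /= /weight big_seq_fset0.
move=> _ [A wA <-]; apply: lb_le_inf.
  by exists `|x - 0|; exists 0 => //; apply: lspan0.
by move=> _ [y yA <-]; apply: H yA.
Qed.

End LinearSpan.

(** * Coefficient functionals and coordinate projections *)

Section Coefficients.
Context {R : realType} {X : completeNormedModType R} {e : nat -> X}.
Context (hbasis : schauder_basis e).
Implicit Types (x y : X) (A B : {fset nat}) (a c : nat -> R).

Lemma coefP x : expands e x (coef e ^~ x).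
Proof.
rewrite (_ : coef e ^~ x = xget (fun=> 0) (expands e x)) //.
by apply: xgetPex; have [a [xa _]] := hbasis x; exists a.
Qed.

Lemma expands_coef {x a} : expands e x a -> forall n, coef e n x = a n.
Proof.
move=> xa n; have [b [_ bU]] := hbasis x.
have := bU _ xa; have := bU _ (coefP x).
by move=> + <- => /(congr1 (fun f => f n)).
Qed.

(** The combined sequence expands $kx + y$, and expansions are unique. *)
Lemma coef_linear n k x y : coef e n (k *: x + y) = k * coef e n x + coef e n y.
Proof.
apply: (@expands_coef _ (fun n => k * coef e n x + coef e n y)).
rewrite /expands.
have -> : (fun n => (k * coef e n x + coef e n y) *: e n) =
    k *: (fun n => coef e n x *: e n) + (fun n => coef e n y *: e n).
  by apply/funext => i; rewrite !fctE /= scalerDl scalerA.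
rewrite seriesD seriesZ.
by apply: cvgD; [apply: cvgZr; apply: coefP|apply: coefP].
Qed.

Lemma coef0 n : coef e n 0 = 0.
Proof. by have := coef_linear n (-1) 0 0; rewrite scaler0 addr0 mulN1r addNr. Qed.

Lemma coefD n x y : coef e n (x + y) = coef e n x + coef e n y.
Proof. by rewrite -[x]scale1r coef_linear mul1r scale1r. Qed.

Lemma coefZ n k x : coef e n (k *: x) = k * coef e n x.
Proof. by have := coef_linear n k x 0; rewrite coef0 !addr0. Qed.

Lemma coef_basis n k : coef e n (e k) = (n == k)%:R.
Proof.
apply: (@expands_coef _ (fun n => (n == k)%:R)).
(* The $m$-th partial sum runs over indices below $m$, so it equals $e_k$ once $m \ge k+1$. *)
apply: cvg_near_cst; exists k.+1 => // m /= km.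
rewrite /series /= (bigD1_seq k) ?mem_index_iota ?iota_uniq //=.
by rewrite eqxx scale1r big1 ?addr0 // => i /negPf ->; rewrite scale0r.
Qed.

Lemma coef_sum n (s : seq nat) c : uniq s ->
  coef e n (\sum_(k <- s) c k *: e k) = if n \in s then c n else 0.
Proof.
elim: s => [_|k s IH /= /andP[ks us]]; first by rewrite big_nil coef0.
rewrite big_cons coef_linear IH // coef_basis inE.
by case: eqVneq => [->|_]; rewrite ?(negPf ks) ?mulr1 ?addr0 ?mulr0 ?add0r.
Qed.

(** The terms of the convergent expansion tend to 0, and their norms are the moduli of the
    coefficients. *)
Lemma coef_bounded (he : forall n, `|e n| = 1) x :
  exists2 M, 0 < M & forall n, `|coef e n x| <= M.
Proof.
have : cvgn (fun n => coef e n x *: e n).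
  apply/cvg_ex; exists 0; apply: cvg_series_cvg_0.
  by apply/cvg_ex; exists x; apply: coefP.
move=> /cvg_seq_bounded /pinfty_ex_gt0[M M0 MP]; exists M => // n.
by have := MP n I; rewrite /= normrZ he mulr1.
Qed.

Lemma proj_linear A k x y : proj e A (k *: x + y) = k *: proj e A x + proj e A y.
Proof.
rewrite /proj scaler_sumr -big_split /=; apply: eq_bigr => n _.
by rewrite coef_linear scalerDl scalerA.
Qed.

Lemma projB A x y : proj e A (x - y) = proj e A x - proj e A y.
Proof. by rewrite -scaleN1r addrC proj_linear scaleN1r addrC. Qed.

Lemma proj_sum A c :
  proj e A (\sum_(k <- A) c k *: e k) = \sum_(k <- A) c k *: e k.
Proof.
apply: eq_big_seq => n nA; congr (_ *: _).
by rewrite coef_sum ?fset_uniq// nA.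
Qed.

Lemma coef_lspan {A y n} : lspan [set e n | n in [set` A]] y ->
  n \notin A -> coef e n y = 0.
Proof.
move=> + nA; apply: (lspan_min _ (fun y => coef e n y = 0)); first exact: coef0.
move=> a _ v [k /= kA <-] v0; rewrite coef_linear v0 addr0 coef_basis.
by case: eqVneq nA => [->|_ _]; rewrite ?kA // mulr0.
Qed.

Lemma proj_lspan {A B y} : lspan [set e n | n in [set` A]] y ->
  {subset A <= B} -> proj e B y = y.
Proof.
move=> + AB; apply: (lspan_min _ (fun y => proj e B y = y)).
  by rewrite /proj big1 // => n _; rewrite coef0 scale0r.
move=> a _ v [k /= kA <-] vB; rewrite proj_linear vB; congr (a *: _ + _).
rewrite /proj (bigD1_seq k) ?fset_uniq ?AB //= coef_basis eqxx scale1r.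
by rewrite big1 ?addr0 // => i /negPf ik; rewrite coef_basis ik scale0r.
Qed.

End Coefficients.

Lemma big_fset_setID (V : nmodType) (A B : {fset nat}) (F : nat -> V) :
  \sum_(n <- A) F n =
  \sum_(n <- (A `&` B)%fset) F n + \sum_(n <- (A `\` B)%fset) F n.
Proof.
rewrite (big_fsetID _ (mem B)) /=; congr (_ + _); apply: perm_big;
  by apply: uniq_perm; rewrite ?fset_uniq // => n; rewrite !inE // andbC.
Qed.

(** * Convexity of the norm and extreme coefficients *)

Section Convexity.
Context {R : realType} {X : completeNormedModType R}.

(** For $M > 0$, $z + cu$ is the convex combination of $z \pm Mu$ with weights $(M \pm c)/(2M)$. *)
Lemma norm_segment_le (z u : X) (M c : R) : `|c| <= M ->
  `|z + c *: u| <= `|z + M *: u| \/ `|z + c *: u| <= `|z - M *: u|.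
Proof.
move=> cM; have M0 : 0 <= M := le_trans (normr_ge0 _) cM.
have [M0'|Mn0] := eqVneq M 0.
  by move: cM; rewrite M0' normr_le0 => /eqP ->; left.
have Mp : 0 < M by rewrite lt_def Mn0.
case/ler_normlP: cM => c1 c2.
pose l := (M + c) / (2 * M); pose r := (M - c) / (2 * M).
have l0 : 0 <= l by apply: divr_ge0; lra.
have r0 : 0 <= r by apply: divr_ge0; lra.
have lr : l + r = 1 by rewrite /l /r; field.
have E : z + c *: u = l *: (z + M *: u) + r *: (z - M *: u).
  rewrite !scalerDr addrACA -scalerDl lr scale1r scalerN -scaleNr !scalerA.
  by rewrite -scalerDl; congr (_ + _ *: _); rewrite /l /r; field.
have := ler_normD (l *: (z + M *: u)) (r *: (z - M *: u)).
rewrite -E (normrZ l) (normrZ r) (ger0_norm l0) (ger0_norm r0) => H.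
have [h|h] := leP `|z + M *: u| `|z - M *: u|; [right|left];
  apply: le_trans H _; clearbody l r; nra.
Qed.

(** Coefficients are pushed to $\pm M$ one at a time. The free vector [z] absorbs the terms already
    pushed, which makes the induction work. *)
Lemma norm_sum_extreme_signs (e : nat -> X) (s : seq nat) (z : X) (M : R)
    (c : nat -> R) :
  uniq s -> (forall n, n \in s -> `|c n| <= M) ->
  exists2 eta : nat -> R, (forall n, eta n = 1 \/ eta n = -1) &
    `|z + \sum_(n <- s) c n *: e n| <=
    `|z + M *: \sum_(n <- s) eta n *: e n|.
Proof.
elim: s z => [|k s IH] z /=.
  by exists (fun=> 1); [left|rewrite !big_nil scaler0].
move=> /andP[ks us] cM.
have [eps [eps1 epsk]] : exists eps : R, (eps = 1 \/ eps = -1) /\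
    `|z + \sum_(n <- s) c n *: e n + c k *: e k| <=
    `|z + \sum_(n <- s) c n *: e n + (M * eps) *: e k|.
  have [h|h] := norm_segment_le (z + \sum_(n <- s) c n *: e n) (e k) M (c k)
    (cM k (mem_head _ _)).
  - by exists 1; split; [left|rewrite mulr1].
  - by exists (-1); split; [right|rewrite mulrN1 scaleNr].
have [|eta eta1 H] := IH (z + (M * eps) *: e k) us.
  by move=> n ns; apply: cM; rewrite inE ns orbT.
exists (fun n => if n == k then eps else eta n) => [n|]; first by case: eqP.
have -> : \sum_(n <- k :: s) (if n == k then eps else eta n) *: e n =
    eps *: e k + \sum_(n <- s) eta n *: e n.
  rewrite big_cons eqxx; congr (_ + _); apply: eq_big_seq => n ns.
  by case: eqVneq ns => // ->; rewrite (negPf ks).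
rewrite big_cons scalerDr scalerA addrA addrAC addrA.
apply: le_trans (_ : _ <= _) H; rewrite addrAC.
by rewrite [X in _ <= `|X|]addrAC; rewrite addrAC in epsk *.
Qed.

End Convexity.

(** * From the PCCG property to greediness *)

Section PCCG.
Context {R : realType} {X : completeNormedModType R} {e : nat -> X}.
Context (hbasis : schauder_basis e) (hnorm : forall n, `|e n| = 1).
Context {w : nat -> R} (hw : forall n, 0 < w n).
Implicit Types (x y : X) (A B G : {fset nat}).

Lemma weight_ge0 A : 0 <= weight w A.
Proof. by apply: sumr_ge0 => n _; apply: ltW. Qed.

Lemma weight_gt0 {A} : A != fset0 -> 0 < weight w A.
Proof.
move=> /fset0Pn[n nA]; rewrite /weight (bigD1_seq n) ?fset_uniq //=.
by apply: ltr_wpDr => //; apply: sumr_ge0 => k _; apply: ltW.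
Qed.

(** The common part $A \cap B$ contributes equally to both weights. *)
Lemma weight_setD {A B} : weight w A <= weight w B ->
  weight w (A `\` B)%fset <= weight w (B `\` A)%fset.
Proof.
rewrite /weight (big_fset_setID _ A B) (big_fset_setID _ B A) fsetIC.
by rewrite lerD2l.
Qed.

(* The PCCG property with the infimum removed; the empty set is harmless
   once D >= 1. *)
Lemma PCCG_bound {s} : PCCG s w e ->
  exists2 D : R, 1 <= D & forall x G A eta a,
    (forall n k, n \in G -> k \notin G -> s * `|coef e k x| <= `|coef e n x|) ->
    signs A eta -> weight w A <= weight w G ->
    `|x - proj e G x| <= D * `|x - a *: indicator e eta A|.
Proof.
move=> [D0 [D0pos HD]]; exists (Num.max 1 D0); first by rewrite le_max lexx.
move=> x G A eta a hG sA wA.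
have [G0|Gn0] := eqVneq G fset0.
  (* A nonempty [A] would have positive weight, exceeding the weight 0 of [G]. *)
  have A0 : A = fset0.
    apply: contraTeq wA => /weight_gt0 wA0.
    by rewrite -ltNge G0 /weight big_seq_fset0.
  rewrite A0 G0 /indicator /proj !big_seq_fset0 scaler0 subr0.
  by rewrite ler_peMl // le_max lexx.
apply: (le_trans (HD x #|` G|%fset G _ _)); first by rewrite cardfs_gt0.
  by split.
apply: ler_pM; first exact: ltW.
- apply: lb_le_inf.
    eexists; exists (A, eta); last by []; by split.
  by move=> _ [p _ <-]; apply: dist_ge0.
- by rewrite le_max lexx orbT.
- exact: calD_le.
Qed.

Lemma PCCG_suppression {s} : s <= 1 -> PCCG s w e ->
  exists2 D : R, 1 <= D & forall x A, `|x - proj e A x| <= D * `|x|.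
Proof.
move=> s1 /PCCG_bound[D D1 HD]; exists D => // x A.
have [M M0 HM] := coef_bounded hbasis hnorm x.
(* With height $2M$, the coefficients of $x + u$ on [A] are at least $2M - M = M$, which bounds
   those off [A]. *)
pose u := (2 * M) *: indicator e (fun=> 1) A.
have cu n : coef e n u = if n \in A then 2 * M else 0.
  rewrite /u /indicator coefZ // coef_sum ?fset_uniq //.
  by case: ifP; rewrite ?mulr1 ?mulr0.
have := HD (x + u) A A (fun=> 1) (2 * M).
rewrite -/u addrK.
have -> : x + u - proj e A (x + u) = x - proj e A x.
  have pu : proj e A u = u.
    rewrite /u /indicator scaler_sumr.
    under eq_bigr do rewrite scalerA.
    exact: proj_sum.
  have := proj_linear hbasis A 1 x u; rewrite !scale1r pu => ->.
  by rewrite opprD addrACA subrr addr0.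
apply=> //; last by left.
move=> n k nA kA; rewrite !coefD // !cu nA (negPf kA) addr0.
apply: le_trans (_ : M <= _).
  apply: le_trans (_ : `|coef e k x| <= _) => //.
  by rewrite ler_piMl.
rewrite ler_normr; apply/orP; left.
by have := HM n => /ler_normlP[h1 h2]; lra.
Qed.

(** Arbitrary coefficients [c] are allowed so that a projection can be inserted directly; convexity
    reduces them to $\pm m$. *)
Lemma PCCG_democracy {s} : 0 < s -> s <= 1 -> PCCG s w e ->
  exists2 D : R, 1 <= D & forall A B (c : nat -> R) x (m : R),
    0 <= m -> [disjoint A & B]%fset -> weight w A <= weight w B ->
    (forall n, n \in A -> `|c n| <= m) ->
    (forall n, n \in B -> m <= `|coef e n x|) ->
    `|\sum_(n <- A) c n *: e n| <= D * `|proj e B x|.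
Proof.
move=> s0 s1 /PCCG_bound[D D1 HD]; exists D => // A B c x m.
move=> m0 /fdisjointP dAB wAB cm mB.
have [eta eta1] := norm_sum_extreme_signs e A 0 m c (fset_uniq A) cm.
rewrite !add0r => /le_trans; apply.
pose u := m *: indicator e eta A.
have cu n : coef e n u = if n \in A then m * eta n else 0.
  rewrite /u /indicator coefZ // coef_sum ?fset_uniq //.
  by case: ifP; rewrite ?mulr0.
have cp n : coef e n (proj e B x) = if n \in B then coef e n x else 0.
  by rewrite /proj coef_sum ?fset_uniq.
have := HD (u + proj e B x) B A eta m.
rewrite -/u [X in D * `|X|]addrAC subrr add0r.
have -> : proj e B (u + proj e B x) = proj e B x.
  apply: eq_big_seq => n nB; congr (_ *: _).
  rewrite coefD // cu cp nB.
  by case: ifP => [/dAB|]; rewrite ?nB // add0r.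
rewrite addrK; apply=> //.
(* Off [B] the coefficients have modulus $m$ on [A] and 0 elsewhere; on [B] they are at least
   $m$. *)
move=> n k nB kB; rewrite !coefD // !cu !cp nB (negPf kB) addr0.
have -> : (n \in A) = false by apply: contraTF nB => /dAB.
rewrite add0r; apply: le_trans (mB n nB).
case: ifP => kA; last first.
  by rewrite normr0 mulr0.
have -> : `|m * eta k| = m.
  by rewrite normrM (ger0_norm m0); case: (eta1 k) => ->; rewrite ?normrN normr1 mulr1.
by rewrite ler_piMl.
Qed.

(** The PCCG property acts only through suppression and democracy at [s]; comparing coefficients
    across the [t]-greedy set costs the factor $t^{-1}$. *)
Lemma PCCG_greedy {s t} : 0 < s -> s <= 1 -> 0 < t -> t <= 1 -> PCCG s w e ->
  greedy_basis t w e.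
Proof.
move=> s0 s1 t0 t1 Hs.
have [D D1 supp] := PCCG_suppression s1 Hs.
have [E E1 demo] := PCCG_democracy s0 s1 Hs.
have D0 : 0 < D by lra.
have E0 : 0 < E by lra.
(* [D] bounds the suppression term, the rest the term $P_{A \setminus G} x$. *)
pose C := D + t^-1 * E * (1 + D).
have C0 : 0 < C by rewrite addr_gt0 // !mulr_gt0 ?invr_gt0 //; lra.
exists C; split=> // x m G _ [_ hG].
rewrite -ler_pdivrMl //; apply: le_sigma; first exact: weight_ge0.
move=> A y wA yA; rewrite ler_pdivrMl //.
set A' := (A `\` G)%fset; set B := (G `\` A)%fset.
have pB : proj e B (x - y) = proj e B x.
  apply: eq_big_seq => n; rewrite !inE => /andP[nA _].
  rewrite -scaleN1r coefD // coefZ // (coef_lspan hbasis yA) //.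
  by rewrite mulr0 addr0.
(* Suppression applied to $P_B = I - (I - P_B)$. *)
have pBle : `|proj e B x| <= (1 + D) * `|x - y|.
  rewrite -pB -[X in `|X| <= _](subKr (x - y)) mulrDl mul1r.
  by apply: le_trans (ler_normB _ _) _; rewrite lerD2l.
(* $P_{G \cup A}$ fixes $y$, so $y$ cancels. *)
have decomp : x - proj e G x =
    (x - y - proj e (G `|` A)%fset (x - y)) + proj e A' x.
  have -> : proj e (G `|` A)%fset (x - y) = proj e G x + proj e A' x - y.
    rewrite projB // (proj_lspan hbasis yA); last first.
      by move=> n nA; rewrite inE nA orbT.
    rewrite /proj (big_fset_setID _ _ G); congr (_ + _ - _);
      apply: perm_big; apply: uniq_perm; rewrite ?fset_uniq // => n;
      by rewrite !inE; case: (n \in G); rewrite ?andbF.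
  by rewrite opprB addrA subrK opprD addrA subrK.
pose M := \big[Num.max/0]_(k <- A') `|coef e k x|.
have M0 : 0 <= M by apply: bigmax_ge_id.
(* Democracy at level $tM$: on [A'] the coefficients of $tx$ are at most $tM$, and greediness of [G]
   makes those of $x$ on [B] at least $tM$. *)
have tail : t * `|proj e A' x| <= E * `|proj e B x|.
  rewrite -[t](gtr0_norm t0) -normrZ /proj scaler_sumr.
  under eq_bigr do rewrite scalerA.
  apply: (demo _ _ _ _ (t * M)).
  - by rewrite mulr_ge0 // ltW.
  - by apply/fdisjointP => n; rewrite !inE => /andP[/negPf -> _]; rewrite andbF.
  - exact: weight_setD.
  - move=> n nA'; rewrite normrM (gtr0_norm t0) ler_pM2l //.
    exact: (@le_bigmax_seq _ _ _ _ 0 n xpredT).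
  - move=> n; rewrite inE => /andP[_ nG].
    rewrite -ler_pdivlMl // /M big_seq; apply: bigmax_le.
      by rewrite mulr_ge0 // invr_ge0 ltW.
    move=> k; rewrite inE => /andP[kG _].
    by rewrite ler_pdivlMl //; apply: hG.
rewrite decomp; apply: le_trans (ler_normD _ _) _.
rewrite mulrDl; apply: lerD; first exact: supp.
rewrite -mulrA -mulrA -ler_pdivrMl ?invr_gt0 // invrK.
by apply: le_trans tail _; rewrite -mulrA ler_pM2l.
Qed.

End PCCG.

Theorem theorem1p4 (R : realType) (X : completeNormedModType R)
    (hdim : infinite_dimensional X)
    (e : nat -> X) (hbasis : schauder_basis e) (hnorm : forall n, `|e n| = 1)
    (w : nat -> R) (hw : forall n, 0 < w n) :
  (exists s : R, 0 < s /\ s <= 1 /\ PCCG s w e) <->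
  (forall t : R, 0 < t -> t <= 1 -> greedy_basis t w e).
Proof.
split=> [[s [s0 [s1 Hs]]] t t0 t1|H].
  exact: (PCCG_greedy hbasis hnorm hw s0 s1 t0 t1 Hs).
(* Greediness at $t = 1$ gives the PCCG property at $s = 1$ with the same constant. *)
exists 1; do !split=> //.
have [C [C0 HC]] := H 1 ltr01 (lexx 1).
exists C; split=> // x m G m0 hG; apply: le_trans (HC x m G m0 hG) _.
by rewrite ler_pM2l //; apply/sigma_le_calD/weight_ge0.
Qed.
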